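(* Let $N\in\mathbb N$. The noncommutative spheres $S^{N-1}_{\mathbb R}\subset S^{N-1}_{\mathbb R,*}\subset S^{N-1}_{\mathbb R,+}$ are the only monomial spheres. That is, these three spheres are monomial, and every monomial sphere $S\subset S^{N-1}_{\mathbb R,+}$ is equal to one of $S^{N-1}_{\mathbb R}$, $S^{N-1}_{\mathbb R,*}$, $S^{N-1}_{\mathbb R,+}$.
   Context: The category of noncommutative compact spaces is the category of unital $C^*$-algebras with arrows reversed. The space corresponding to the algebra $A$ is written $X=\mathrm{Spec}(A)$, and one writes $A=C(X)$. A (closed) subset $Y\subset X$ is a quotient $C(X)\to C(Y)$ of unital $C^*$-algebras. The subset of $X$ obtained via a family of relations is the one whose algebra is the quotient of $C(X)$ by the closed two-sided ideal generated by these relations. Two subsets of $X$ are equal when the corresponding quotients of $C(X)$ have the same kernel. The free real sphere $S^{N-1}_{\mathbb R,+}$ is defined by the universal unital $C^*$-algebra $$C(S^{N-1}_{\mathbb R,+})=C^*\Big(x_1,\ldots,x_N\,\Big|\,x_i=x_i^*,\ \sum_i x_i^2=1\Big).$$ The half-liberated sphere $S^{N-1}_{\mathbb R,*}\subset S^{N-1}_{\mathbb R,+}$ is obtained via the relations $x_ix_jx_k=x_kx_jx_i$ for all $i,j,k\in\{1,\ldots,N\}$. The usual unit sphere $S^{N-1}_{\mathbb R}\subset\mathbb R^N$ is viewed as the subset of $S^{N-1}_{\mathbb R,+}$ obtained via the relations $x_ix_j=x_jx_i$ for all $i,j$, with $x_i$ being the standard coordinates. A monomial sphere is a subset $S\subset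 S^{N-1}_{\mathbb R,+}$ obtained via a (possibly empty) family of relations of the type $$x_{i_1}\cdots x_{i_k}=x_{i_{\sigma(1)}}\cdots x_{i_{\sigma(k)}},\qquad \forall (i_1,\ldots,i_k)\in\{1,\ldots,N\}^k,$$ with $\sigma$ ranging over a certain set of permutations $\sigma\in S_k$, of variable size $k\in\mathbb N$. *)

(* Defs.v *)
From HB Require Import structures.
From mathcomp Require Import all_boot all_order all_algebra all_fingroup.
From mathcomp Require Import all_classical all_reals all_analysis.
From mathcomp Require Import complex.

Set Implicit Arguments.
Unset Strict Implicit.
Unset Printing Implicit Defensive.

Import Order.TTheory GRing.Theory Num.Theory.
Import numFieldNormedType.Exports.
Local Open Scope classical_set_scope.
Local Open Scope ring_scope.
Local Open Scope complex_scope.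

(* The multiplicative structure is not inherited from the library's algebras:
   algType imposes 1 != 0, whereas the zero algebra (the empty noncommutative
   space) is a unital C*-algebra, and the library's hierarchy only joins rings
   and normed modules at numDomainType.  The ring structure is declared on every
   cstarType below.  The norm of a normed module over R[i] takes its values in
   the nonnegative reals of R[i]. *)
HB.mixin Record isCStar (R : realType) A of CompleteNormedModule R[i] A := {
  cstar_one : A;
  cstar_mul : A -> A -> A;
  star : A -> A;
  cstar_mulA : associative cstar_mul;
  cstar_mul1r : left_id cstar_one cstar_mul;
  cstar_mulr1 : right_id cstar_one cstar_mul;
  cstar_mulDl : left_distributive cstar_mul +%R;
  cstar_mulDr : right_distributive cstar_mul +%R;
  cstar_scalerAl : forall (k : R[i]) (a b : A),
    k *: cstar_mul a b = cstar_mul (k *: a) b;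
  cstar_scalerAr : forall (k : R[i]) (a b : A),
    k *: cstar_mul a b = cstar_mul a (k *: b);
  starK : involutive star;
  starD : {morph star : a b / a + b};
  starZ : forall (k : R[i]) (a : A), star (k *: a) = Num.conj k *: star a;
  starM : forall a b : A, star (cstar_mul a b) = cstar_mul (star b) (star a);
  cstar_normM : forall a b : A, `|cstar_mul a b| <= `|a| * `|b|;
  cstar_norm_star : forall a : A, `|cstar_mul (star a) a| = `|a| ^+ 2
}.

#[short(type="cstarType")]
HB.structure Definition CStar (R : realType) :=
  {A of CompleteNormedModule R[i] A & isCStar R A}.

HB.instance Definition _ (R : realType) (A : cstarType R) :=
  GRing.Zmodule_isPzRing.Build (CStar.sort A)
    (@cstar_mulA R A) (@cstar_mul1r R A) (@cstar_mulr1 R A)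
    (@cstar_mulDl R A) (@cstar_mulDr R A).

(* Unital *-homomorphisms; continuity is automatic between C*-algebras. *)
Definition star_hom (R : realType) (A B : cstarType R) (f : A -> B) : Prop :=
  [/\ linear f, monoid_morphism f & {morph f : a / star a}].

Definition sphere_relations (R : realType) (N : nat) (A : cstarType R)
    (x : 'I_N -> A) : Prop :=
  (forall i, star (x i) = x i) /\ \sum_i x i ^+ 2 = 1.

(* (A, x) is C(S^{N-1}_{R,+}) with its standard coordinates: the universal
   property determines it up to a unique isomorphism. *)
Definition is_free_sphere (R : realType) (N : nat) (A : cstarType R)
    (x : 'I_N -> A) : Prop :=
  sphere_relations x /\
  forall (B : cstarType R) (y : 'I_N -> B), sphere_relations y ->
    exists! f : A -> B, star_hom f /\ forall i, f (x i) = y i.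

Definition closed_ideal (R : realType) (A : cstarType R) (I : set A) : Prop :=
  [/\ closed I, I 0, forall a b, I a -> I b -> I (a + b),
      forall c a, I a -> I (c * a) & forall c a, I a -> I (a * c)].

(* A closed subset Y of Spec A, given by the kernel of its quotient map
   A -> C(Y) = A / nc_kernel Y.  Kernels of quotients of unital C*-algebras are
   exactly the closed two-sided ideals. *)
Record nc_subset (R : realType) (A : cstarType R) := NCSubset {
  nc_kernel :> set A;
  nc_kernel_closed_ideal : closed_ideal nc_kernel
}.

Definition subset_eq (R : realType) (A : cstarType R) (Y Z : nc_subset A) :
    Prop :=
  nc_kernel Y = nc_kernel Z.

(* Y is contained in Z when A -> C(Y) factors through A -> C(Z). *)
Definition subset_le (R : realType) (A : cstarType R) (Y Z : nc_subset A) :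
    Prop :=
  nc_kernel Z `<=` nc_kernel Y.

Definition differences (R : realType) (A : cstarType R) (rel : set (A * A)) :
    set A :=
  [set r.1 - r.2 | r in rel].

Lemma smallest_closed_ideal (R : realType) (A : cstarType R) (G : set A) :
  closed_ideal (smallest (@closed_ideal R A) G).
Proof.
split.
- by apply: closed_bigI => I [[]].
- by move=> I [[]].
- by move=> a b Ia Ib I HI; case: (HI) => -[_ _ D _ _] _; apply: D;
    [exact: Ia | exact: Ib].
- by move=> c a Ia I HI; case: (HI) => -[_ _ _ M _] _; apply: M; exact: Ia.
- by move=> c a Ia I HI; case: (HI) => -[_ _ _ _ M] _; apply: M; exact: Ia.
Qed.

(* The subset obtained via the relations a = b, for (a, b) in rel. *)
Definition obtained_via (R : realType) (A : cstarType R) (rel : set (A * A)) :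
    nc_subset A :=
  NCSubset (smallest_closed_ideal (differences rel)).

Definition free_sphere (R : realType) (A : cstarType R) : nc_subset A :=
  obtained_via set0.

Definition half_liberated_sphere (R : realType) (N : nat) (A : cstarType R)
    (x : 'I_N -> A) : nc_subset A :=
  obtained_via [set r | exists i j k : 'I_N,
    r = (x i * x j * x k, x k * x j * x i)].

Definition classical_sphere (R : realType) (N : nat) (A : cstarType R)
    (x : 'I_N -> A) : nc_subset A :=
  obtained_via [set r | exists i j : 'I_N, r = (x i * x j, x j * x i)].

Definition monomial_relations (R : realType) (N : nat) (A : cstarType R)
    (x : 'I_N -> A) (E : forall k, set 'S_k) : set (A * A) :=
  [set r | exists k (s : 'S_k) (i : {ffun 'I_k -> 'I_N}),
    E k s /\ r = (\prod_(j < k) x (i j), \prod_(j < k) x (i (s j)))].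

Definition monomial_sphere (R : realType) (N : nat) (A : cstarType R)
    (x : 'I_N -> A) (S : nc_subset A) : Prop :=
  exists E : forall k, set 'S_k,
    subset_eq S (obtained_via (monomial_relations x E)).

(* Main.v *)
Require Import Defs.
From mathcomp Require Import all_boot all_order all_algebra all_fingroup.
From mathcomp Require Import all_classical all_reals all_analysis.
From mathcomp Require Import zify.

(** Only the relation [\sum_t x_t ^ 2 = 1] of the free sphere matters, and only
    through an operation on words: if [u t t v = u' t t v'] holds in a quotient
    for all letters [t], then summing over [t] gives [u v = u' v'].  So common
    prefixes, common suffixes and squares inside common blocks can be cancelled
    from monomial relations.  The permutations whose relations hold in a given
    quotient are moreover stable under products, inverses, and the addition of
    fixed points on either side.

    Suppose a nontrivial permutation [f] is realised in this sense.  Its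
    translate far enough to the right has a support meeting that of [f] in one
    point, so their commutator is a 3-cycle, and cancelling the inert letters
    leaves 3-cycles with blocks of length at most one between the moving
    letters.  Each of them gives [a b c = c b a], the relation of the
    half-liberated sphere ([nontrivial_half_commutation]).  If [f] moreover sends
    some position to one of the other parity, then, conjugating by [f] a
    transposition of positions of equal parity, which half-commutation realises,
    gives a transposition of positions of different parities, and cancelling the
    letters in between leaves [a b = b a] ([parity_breaking_commutation]).

    Conversely commutation realises all transpositions, and half-commutation
    those of positions of equal parity; these generate all permutations,
    respectively all those preserving the parity of positions
    ([realised_of_transpositions]).  A monomial sphere is thus classical,
    half-liberated or free according to whether its permutations include one
    breaking parity, or else a nontrivial one, or else none.  The half-liberated
    sphere is presented as monomial by the set of all parity-preserving
    permutations. *)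

Set Implicit Arguments.
Unset Strict Implicit.
Unset Printing Implicit Defensive.

Import Order.TTheory GRing.Theory.

(** * Word congruences with capping *)

(** The combinatorial shadow of a quotient of a free sphere: two words are
    related when their monomials agree in the quotient.  The last clause is the
    only trace of the relation [\sum_t x_t ^ 2 = 1]: if two words stay related
    whenever the same square [t t] is inserted in both, summing over [t] removes
    the square. *)
Record capping_congruence (T : Type) (r : seq T -> seq T -> Prop) : Prop := {
  capping_refl : forall u, r u u;
  capping_sym : forall u v, r u v -> r v u;
  capping_trans : forall v u w, r u v -> r v w -> r u w;
  capping_cat : forall u u' v v', r u u' -> r v v' -> r (u ++ v) (u' ++ v');
  capping_cap : forall u v u' v',
    (forall t, r (u ++ [:: t; t] ++ v) (u' ++ [:: t; t] ++ v')) ->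
    r (u ++ v) (u' ++ v')
}.

(** [a B c ~ c B a] for a block [B] of fixed length: length [0] is commutation
    and length [1] is half-commutation. *)
Definition reversal_of_length (T : Type) (r : seq T -> seq T -> Prop) (b : nat) :
    Prop :=
  forall a c B, size B = b -> r (a :: B ++ [:: c]) (c :: B ++ [:: a]).

(** The word form of a 3-cycle of positions, with blocks of fixed lengths
    between the three moving letters. *)
Definition rotation_of_lengths (T : Type) (r : seq T -> seq T -> Prop)
    (b c : nat) : Prop :=
  forall k l m B C, size B = b -> size C = c ->
    r (k :: B ++ l :: C ++ [:: m]) (m :: B ++ k :: C ++ [:: l]).

Section Words.

Variables (T : Type) (r : seq T -> seq T -> Prop).
Hypothesis rC : capping_congruence r.

Let rrefl u : r u u. Proof. exact: capping_refl. Qed.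

Lemma congr_prefix w u v : r u v -> r (w ++ u) (w ++ v).
Proof. by move=> ruv; apply: capping_cat. Qed.

Lemma congr_suffix w u v : r u v -> r (u ++ w) (v ++ w).
Proof. by move=> ruv; apply: capping_cat. Qed.

Lemma congr_cons a u v : r u v -> r (a :: u) (a :: v).
Proof. exact: (@congr_prefix [:: a]). Qed.

Lemma cancel_prefix n u v :
  (forall P, size P = n -> r (P ++ u) (P ++ v)) -> r u v.
Proof.
elim: n => [|n IHn] H; first exact: (H [::]).
apply: IHn => P sP.
apply: (capping_cap rC (u := [::]) (u' := [::])) => t.
by apply: (@congr_cons t); apply: (H (t :: P)); rewrite /= sP.
Qed.

Lemma cancel_suffix n u v :
  (forall S, size S = n -> r (u ++ S) (v ++ S)) -> r u v.
Proof.
elim: n => [|n IHn] H; first by rewrite -[u]cats0 -[v]cats0; apply: H.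
apply: IHn => S sS; rewrite -[u ++ S]cats0 -[v ++ S]cats0.
apply: (capping_cap rC) => t; rewrite !cats0.
have := @congr_suffix [:: t] _ _ (H (rcons S t) _).
by rewrite -!cats1 -!catA; apply; rewrite size_cat addn1 sS.
Qed.

(** A block standing unbroken on both sides may end in a square, which capping
    removes; repeating this leaves at most one letter, according to parity. *)
Lemma shorten_reversal b :
  reversal_of_length r b.+2 -> reversal_of_length r b.
Proof.
move=> H a c B sB.
apply: (capping_cap rC (u := [:: a]) (u' := [:: c])) => t.
by apply: (H a c (t :: t :: B)); rewrite /= sB.
Qed.

Lemma shorten_reversals b : reversal_of_length r b -> reversal_of_length r (odd b).
Proof.
elim/ltn_ind: b => -[|[|b]] IH H //=.
by rewrite negbK; apply: IH => //; apply: shorten_reversal.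
Qed.

Lemma shorten_rotation_left b c :
  rotation_of_lengths r b c -> rotation_of_lengths r (odd b) c.
Proof.
elim/ltn_ind: b => -[|[|b]] IH H //=.
rewrite negbK; apply: IH => // k l m B C sB sC.
apply: (capping_cap rC (u := [:: k]) (u' := [:: m])) => t.
by apply: (H k l m (t :: t :: B)); rewrite /= ?sB.
Qed.

Lemma shorten_rotation_right b c :
  rotation_of_lengths r b c -> rotation_of_lengths r b (odd c).
Proof.
elim/ltn_ind: c => -[|[|c]] IH H //=.
rewrite negbK; apply: IH => // k l m B C sB sC.
have := capping_cap rC (u := k :: B ++ [:: l]) (u' := m :: B ++ [:: k])
  (v := C ++ [:: m]) (v' := C ++ [:: l]).
rewrite /= -!catA /=; apply => t; rewrite -!catA /=.
by apply: (H k l m B (t :: t :: C)); rewrite /= ?sC.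
Qed.

Lemma commutation_half_commutation :
  reversal_of_length r 0 -> reversal_of_length r 1.
Proof.
move=> comm a c [|b []] //= _.
have swp u v w : r (u :: v :: w) (v :: u :: w).
  exact: (@congr_suffix w _ _ (comm u v [::] erefl)).
apply: (capping_trans rC (swp _ _ _)).
apply: (capping_trans rC (congr_cons _ (swp _ _ _))); exact: swp.
Qed.

(** [a s t B c ~ t s a B c ~ t s c B a ~ c s t B a]. *)
Lemma lengthen_reversal b :
  reversal_of_length r 1 -> reversal_of_length r b -> reversal_of_length r b.+2.
Proof.
move=> half H a c [|s [|t B]] //= [sB].
have rev3 u v w W : r (u :: v :: w :: W) (w :: v :: u :: W).
  exact: (@congr_suffix W _ _ (half u w [:: v] erefl)).
apply: (capping_trans rC (rev3 _ _ _ _)).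
apply: (capping_trans rC (congr_cons _ (congr_cons _ (H a c B sB)))).
exact: rev3.
Qed.

Lemma half_commutation_odd_reversals b :
  reversal_of_length r 1 -> odd b -> reversal_of_length r b.
Proof.
move=> half; elim/ltn_ind: b => -[|[|b]] IH //=; rewrite negbK => ob.
by apply: lengthen_reversal => //; apply: IH.
Qed.

Lemma commutation_reversals b :
  reversal_of_length r 0 -> reversal_of_length r b.
Proof.
move=> comm; have half := commutation_half_commutation comm.
elim/ltn_ind: b => -[|[|b]] IH //.
by apply: lengthen_reversal => //; apply: IH.
Qed.

(** 3-cycles of consecutive positions generate the alternating group, which
    contains the double transposition [c d e f ~ d c f e]; with [c = d = t] it
    reads [t t e f ~ t t f e]. *)
Lemma rotation00_commutation :
  rotation_of_lengths r 0 0 -> reversal_of_length r 0.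
Proof.
move=> rot c d [] //= _.
have rot3 k l m W : r (k :: l :: m :: W) (m :: k :: l :: W).
  exact: (@congr_suffix W _ _ (rot k l m [::] [::] erefl erefl)).
have rot3' h k l m : r [:: h; k; l; m] [:: h; m; k; l].
  exact: congr_cons (rot k l m [::] [::] erefl erefl).
apply: (capping_cap rC (u := [::]) (u' := [::]) (v := [:: c; d])
  (v' := [:: d; c])) => t.
apply: (capping_trans rC (rot3 _ _ _ _)).
apply: (capping_trans rC (rot3' _ _ _ _)).
apply: (capping_trans rC (rot3' _ _ _ _)).
apply: (capping_trans rC (rot3 _ _ _ _)).
apply: (capping_trans rC (rot3 _ _ _ _)); exact: rot3'.
Qed.

(** After shortening the blocks to length at most one, a square can be formed
    from neighbouring letters that stay neighbours on the other side, and what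
    survives its removal is a reversal.  With no letter between the
    moving ones the only such pair leaves [a ~ a], whence the separate argument
    above. *)
Lemma rotation_half_commutation b c :
  rotation_of_lengths r b c -> reversal_of_length r 1.
Proof.
move/shorten_rotation_left/shorten_rotation_right.
case: (odd b) (odd c) => -[] rot.
- move=> k l [|m []] //= _.
  apply: (capping_cap rC (u := [::]) (u' := [:: l])) => t.
  exact: (rot t k l [:: t] [:: m]).
- apply: commutation_half_commutation => k l [|//] _.
  apply: (capping_cap rC (u := [::]) (u' := [:: l])) => t.
  exact: (rot t k l [:: t] [::]).
- apply: commutation_half_commutation => k l [|//] _.
  apply: (capping_cap rC (u := [:: k]) (u' := [:: l; k])
    (v' := [::])) => t.
  exact: (rot k t l [::] [:: t]).
- exact: commutation_half_commutation (rotation00_commutation rot).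
Qed.

End Words.

(** * Permutations acting on words *)

(** Permutations are bijections of [nat] fixing every large position, so that
    composing, widening and shifting them changes no type. *)
Definition realised (T : Type) (r : seq T -> seq T -> Prop) (n : nat)
    (f : nat -> nat) : Prop :=
  forall i : nat -> T, r (map i (iota 0 n)) (map (i \o f) (iota 0 n)).

Definition swapn (p q j : nat) : nat :=
  if j == p then q else if j == q then p else j.

Definition shiftn (d : nat) (f : nat -> nat) (j : nat) : nat :=
  if j < d then j else d + f (j - d).

Definition is_rotation (p q m : nat) (c : nat -> nat) : Prop :=
  [/\ c p = m, c m = q, c q = p &
      forall j, j != p -> j != q -> j != m -> c j = j].

Lemma map_nth_block (T : Type) (d : T) (w P B S : seq T) p b :
  w = P ++ B ++ S -> size P = p -> size B = b -> map (nth d w) (iota p b) = B.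
Proof.
move=> -> <- <-; apply: (@eq_from_nth _ d); rewrite size_map size_iota // => j jB.
rewrite (nth_map 0) ?size_iota // nth_iota // nth_cat ltnNge leq_addr addKn.
by rewrite nth_cat jB.
Qed.

Lemma nth_letter (T : Type) (d : T) (w P S : seq T) a p :
  w = P ++ a :: S -> size P = p -> nth d w p = a.
Proof. by move=> -> <-; rewrite nth_cat ltnn subnn. Qed.

Lemma map_comp_fixed (T : Type) (i : nat -> T) (f : nat -> nat) (p n : nat) :
  (forall j, p <= j < p + n -> f j = j) ->
  map (i \o f) (iota p n) = map i (iota p n).
Proof. by move=> H; apply/eq_in_map => j; rewrite mem_iota => /H /= ->. Qed.

(** The two splittings below isolate the two, respectively three, positions
    moved by a transposition or a 3-cycle from the blocks between them. *)
Lemma map_iota_split2 (T : Type) (h : nat -> T) (p b s : nat) :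
  map h (iota 0 (p + (b.+1 + s.+1))) =
  map h (iota 0 p) ++
  (h p :: map h (iota p.+1 b) ++ [:: h (p + b.+1)]) ++
  map h (iota (p + b.+1).+1 s).
Proof. by rewrite !iotaD !map_cat /= add0n -catA. Qed.

Lemma map_iota_split3 (T : Type) (h : nat -> T) (p b c s : nat) :
  map h (iota 0 (p + (b.+1 + (c.+1 + s.+1)))) =
  map h (iota 0 p) ++
  (h p :: map h (iota p.+1 b) ++
   h (p + b.+1) :: map h (iota (p + b.+1).+1 c) ++ [:: h (p + b.+1 + c.+1)]) ++
  map h (iota (p + b.+1 + c.+1).+1 s).
Proof.
by rewrite !iotaD !map_cat /= add0n -!catA /= -catA.
Qed.

Lemma swapnL p q : swapn p q p = q.
Proof. by rewrite /swapn eqxx. Qed.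

Lemma swapnR p q : swapn p q q = p.
Proof. by rewrite /swapn eqxx; case: eqP. Qed.

Lemma swapnD p q j : j != p -> j != q -> swapn p q j = j.
Proof. by rewrite /swapn => /negPf-> /negPf->. Qed.

Lemma swapnK p q : involutive (swapn p q).
Proof.
move=> j; case: (eqVneq j p) => [->|jp]; first by rewrite swapnL swapnR.
case: (eqVneq j q) => [->|jq]; first by rewrite swapnR swapnL.
by rewrite !swapnD.
Qed.

Lemma map_swapn (T : Type) (i : nat -> T) p b s :
  map (i \o swapn p (p + b.+1)) (iota 0 (p + (b.+1 + s.+1))) =
  map i (iota 0 p) ++
  (i (p + b.+1) :: map i (iota p.+1 b) ++ [:: i p]) ++
  map i (iota (p + b.+1).+1 s).
Proof.
rewrite map_iota_split2 /= swapnL swapnR !map_comp_fixed // => j jP;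
  apply: swapnD; lia.
Qed.

(** Two permutations whose supports meet in a single point [q] have a 3-cycle as
    commutator: conjugating [h] by [f] only replaces [q] by [f q] in the cycles
    of [h]. *)
Lemma commutator_rotation q f f' h h' : cancel f f' -> cancel f' f ->
  cancel h h' -> cancel h' h ->
  (forall j, q < j -> f j = j) -> (forall j, j < q -> h j = j) ->
  f q != q -> h q != q ->
  [/\ f q < q, q < h q & is_rotation (f q) q (h q) (f \o h \o f' \o h')].
Proof.
move=> fK f'K hK h'K ff hf fq hq.
have f'f j : q < j -> f' j = j by move=> /ff {1}<-; rewrite fK.
have h'f j : j < q -> h' j = j by move=> /hf {1}<-; rewrite hK.
have fqL : f q < q.
  rewrite ltn_neqAle fq /= leqNgt; apply/negP => /ff /(can_inj fK) E.
  by rewrite E eqxx in fq.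
have hqL : q < h q.
  rewrite ltn_neqAle eq_sym hq /= leqNgt; apply/negP => /hf /(can_inj hK) E.
  by rewrite E eqxx in hq.
split=> //; split=> /=.
- by rewrite h'f // fK ff.
- rewrite hK.
  have : f' q < q.
    rewrite ltn_neqAle; apply/andP; split.
      by apply: (contraNneq _ fq) => E; rewrite -{1}E f'K.
    rewrite leqNgt; apply/negP => /[dup] /ff; rewrite f'K => <-.
    by rewrite ltnn.
  by move=> /hf ->; rewrite f'K.
- have h'q : q < h' q.
    rewrite ltn_neqAle; apply/andP; split.
      by apply: (contraNneq _ hq) => E; rewrite {1}E h'K.
    rewrite leqNgt; apply/negP => /[dup] /hf; rewrite h'K => <-.
    by rewrite ltnn.
  by rewrite f'f // h'K.
move=> j jp jq jm; case: (ltngtP j q) => [jL|jL|jE]; last by rewrite jE eqxx in jq.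
- rewrite h'f //.
  have : f' j < q.
    rewrite ltn_neqAle; apply/andP; split.
      by apply: contraNneq jp => <-; rewrite f'K.
    rewrite leqNgt; apply/negP => /[dup] /ff; rewrite f'K => <- L.
    by rewrite ltnNge (ltnW L) in jL.
  by move=> /hf ->; rewrite f'K.
- have h'j : q < h' j.
    rewrite ltn_neqAle; apply/andP; split.
      by rewrite eq_sym; apply: contraNneq jm => <-; rewrite h'K.
    rewrite leqNgt; apply/negP => /[dup] /hf; rewrite h'K => <- L.
    by rewrite ltnNge (ltnW L) in jL.
  by rewrite f'f // h'K ff.
Qed.

Section Realised.

Variables (T : Type) (r : seq T -> seq T -> Prop).
Hypothesis rC : capping_congruence r.

Let rrefl u : r u u. Proof. exact: capping_refl. Qed.

Lemma realised_ext n f g : (forall j, j < n -> f j = g j) ->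
  realised r n f -> realised r n g.
Proof.
move=> fg rf i; have /eq_in_map <- // : {in iota 0 n, i \o f =1 i \o g}.
by move=> j; rewrite mem_iota /= => /fg ->.
Qed.

Lemma realised_comp n f g :
  realised r n f -> realised r n g -> realised r n (f \o g).
Proof.
by move=> rf rg i; apply: (capping_trans rC (rf i)); apply: (rg (i \o f)).
Qed.

Lemma realised_inv n f g : cancel f g -> realised r n f -> realised r n g.
Proof.
move=> fK rf i; apply: (capping_sym rC).
have := rf (i \o g); rewrite (eq_map (_ : (i \o g) \o f =1 i)) // => j /=.
by rewrite fK.
Qed.

Lemma realised_widen m n f : (forall j, n <= j -> f j = j) ->
  realised r n f -> realised r (n + m) f.
Proof.
move=> ffix rf i; rewrite iotaD !map_cat; apply: (capping_cat rC) => //.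
have /eq_in_map <- // : {in iota (0 + n) m, i =1 i \o f}.
by move=> j; rewrite mem_iota => /andP[nj _] /=; rewrite ffix.
Qed.

Lemma realised_shift d n f : realised r n f -> realised r (d + n) (shiftn d f).
Proof.
move=> rf i; rewrite iotaD !map_cat; apply: (capping_cat rC).
  have /eq_in_map <- // : {in iota 0 d, i =1 i \o shiftn d f}.
  by move=> j; rewrite mem_iota add0n /shiftn /= => ->.
rewrite add0n -[X in iota X n]addn0 iotaDl -!map_comp.
rewrite (eq_map (_ : (i \o shiftn d f) \o addn d =1 (i \o addn d) \o f)) // => j /=.
by rewrite /shiftn ltnNge leq_addr addKn.
Qed.

Lemma realised_swapn p q n : p < q -> q < n ->
  reversal_of_length r (q - p.+1) -> realised r n (swapn p q).
Proof.
move=> pq qn H i.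
have [b qE] : exists b, q = p + b.+1 by exists (q - p.+1); lia.
have [s nE] : exists s, n = p + (b.+1 + s.+1) by exists (n - q.+1); lia.
rewrite {q}qE {n}nE in pq qn H *.
rewrite map_swapn map_iota_split2.
apply: congr_prefix => //; apply: congr_suffix => //; apply: H.
by rewrite size_map size_iota; lia.
Qed.

(** The letters outside the two exchanged positions form a common prefix and a
    common suffix, which capping cancels. *)
Lemma reversal_of_swapn p q n : p < q -> q < n ->
  realised r n (swapn p q) -> reversal_of_length r (q - p.+1).
Proof.
move=> pq qn rs k l B sB.
apply: (cancel_prefix rC (n := p)) => P sP.
apply: (cancel_suffix rC (n := n - q.+1)) => S sS.
pose w := P ++ (k :: B ++ [:: l]) ++ S.
have qE : q = size P + (size B).+1 by lia.
have nE : n = size P + ((size B).+1 + (size S).+1) by lia.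
have := rs (nth k w); rewrite -sP qE nE map_swapn map_iota_split2.
rewrite (@map_nth_block _ _ _ [::] P ((k :: B ++ [:: l]) ++ S)) //.
rewrite (@nth_letter _ _ _ P (B ++ [:: l] ++ S) k) //; last by rewrite /w /= -catA.
rewrite (@map_nth_block _ _ _ (rcons P k) B (l :: S)) //; first last.
- by rewrite size_rcons.
- by rewrite /w -cats1 -!catA /= -catA.
rewrite (@nth_letter _ _ _ (P ++ k :: B) S l) //; first last.
- by rewrite size_cat.
- by rewrite /w -!catA /= -catA.
rewrite (@map_nth_block _ _ _ (P ++ k :: B ++ [:: l]) S [::]) //; first last.
- by rewrite size_cat /= size_cat addn1 addnS.
- by rewrite cats0 /w /= -!catA /= -!catA.
by rewrite -!(catA P).
Qed.

Lemma rotation_of_realised p q m n c : is_rotation p q m c ->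
  p < q -> q < m -> m < n ->
  realised r n c -> rotation_of_lengths r (q - p.+1) (m - q.+1).
Proof.
move=> [cp cm cq cf] pq qm mn rc k l t B C sB sC.
apply: (cancel_prefix rC (n := p)) => P sP.
apply: (cancel_suffix rC (n := n - m.+1)) => S sS.
pose w := P ++ (k :: B ++ l :: C ++ [:: t]) ++ S.
have qE : q = size P + (size B).+1 by lia.
have mE : m = q + (size C).+1 by lia.
have nE : n = size P + ((size B).+1 + ((size C).+1 + (size S).+1)) by lia.
have := rc (nth k w); rewrite nE !map_iota_split3 /= -qE -mE sP cp cq cm.
rewrite !(@map_comp_fixed _ _ c); try by move=> j jP; apply: cf; lia.
rewrite (@map_nth_block _ _ _ [::] P ((k :: B ++ l :: C ++ [:: t]) ++ S)) //.
rewrite (@nth_letter _ _ _ P (B ++ l :: C ++ [:: t] ++ S) k) //; last first.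
  by rewrite /w /= -!catA /= -!catA.
rewrite (@map_nth_block _ _ _ (rcons P k) B (l :: C ++ [:: t] ++ S)) //; first last.
- by rewrite size_rcons sP.
- by rewrite /w -cats1 -!catA /= -!catA /= -!catA.
rewrite (@nth_letter _ _ _ (P ++ k :: B) (C ++ [:: t] ++ S) l) //; first last.
- by rewrite size_cat qE.
- by rewrite /w -!catA /= -!catA /= -!catA.
rewrite (@map_nth_block _ _ _ (P ++ k :: B ++ [:: l]) C (t :: S)) //; first last.
- by rewrite size_cat /= size_cat /=; lia.
- by rewrite /w -!catA /= -!catA /= -!catA.
rewrite (@nth_letter _ _ _ (P ++ k :: B ++ l :: C) S t) //; first last.
- by rewrite size_cat /= size_cat /=; lia.
- by rewrite /w -!catA /= -!catA /= -!catA.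
rewrite (@map_nth_block _ _ _ (P ++ k :: B ++ l :: C ++ [:: t]) S [::]) //; first last.
- by rewrite size_cat /= size_cat /= size_cat /=; lia.
- by rewrite cats0 /w /= -!catA /= -!catA /= -!catA.
by rewrite -!(catA P).
Qed.

(** Let [p] and [q] be the least and the greatest positions moved by [f].  The
    translate of [f] by [q - p] moves no position below [q], so its support
    meets that of [f] in [q] only, and the commutator of the two is a
    3-cycle. *)
Lemma nontrivial_half_commutation n f g : cancel f g -> cancel g f ->
  (forall j, n <= j -> f j = j) -> realised r n f ->
  forall j, f j != j -> reversal_of_length r 1.
Proof.
move=> fK gK ffix rf j0 j0P.
have ex : exists j, f j != j by exists j0.
have bound j : f j != j -> j <= n.
  by case: (leqP j n) => // /ltnW /ffix ->; rewrite eqxx.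
case: (ex_minnP ex) => p fp pmin; case: (ex_maxnP ex bound) => q fq qmax.
have pq : p <= q by apply: qmax.
pose d := q - p.
have shiftK u v : cancel u v -> cancel (shiftn d u) (shiftn d v).
  move=> uK j; rewrite /shiftn; case: (ltnP j d) => [-> //|dj].
  by rewrite ltnNge leq_addr /= addKn uK subnKC.
have qn : q < n by rewrite ltnNge; apply: contra fq => /ffix ->.
have ff j : q < j -> f j = j.
  by move=> qj; apply/eqP; apply: contraTT qj => /qmax; rewrite -leqNgt.
have hf j : j < q -> shiftn d f j = j.
  move=> jq; rewrite /shiftn; case: ltnP => // dj.
  have : f (j - d) = j - d.
    by apply: contraTeq jq => /pmin; rewrite -leqNgt leq_subRL // addnC subnKC.
  by move=> ->; rewrite subnKC.
have hq : shiftn d f q = d + f p.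
  by rewrite /shiftn ltnNge leq_subr /= /d subKn.
have hqq : shiftn d f q != q.
  rewrite hq -[X in _ != X](subnK pq) eqn_add2l //.
have [L1 L2 rot] := commutator_rotation fK gK (shiftK _ _ fK) (shiftK _ _ gK)
  ff hf fq hqq.
have rdf : realised r (d + n) f.
  by rewrite addnC; apply: realised_widen.
have rdh := realised_shift d rf.
apply: (rotation_half_commutation rC).
apply: (rotation_of_realised rot L1 L2 (n := d + n)).
  rewrite hq ltn_add2l ltnNge; apply/negP => np.
  have E : f (f p) = f p by apply: ffix.
  by move/(can_inj fK): E fp => ->; rewrite eqxx.
apply: realised_comp => //; last exact: realised_inv (shiftK _ _ fK) rdh.
apply: realised_comp => //; last exact: realised_inv fK rdf.
exact: realised_comp.
Qed.

(** Permutations preserving a colouring [kappa] of the positions are products of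
    transpositions exchanging positions of the same colour: composing with one
    of them makes the last position fixed, and induction applies.  A constant
    colouring treats all permutations at once, the colouring by parity those
    which preserve the parity of positions. *)
Lemma realised_of_transpositions (K : eqType) (kappa : nat -> K) :
  (forall p q, p < q -> kappa p = kappa q -> reversal_of_length r (q - p.+1)) ->
  forall n f g, cancel f g -> cancel g f -> (forall j, n <= j -> f j = j) ->
    (forall j, kappa (f j) = kappa j) -> realised r n f.
Proof.
move=> swaps; elim=> [|n IHn] f g fK gK ffix fkap.
  by move=> i; apply: capping_refl.
have gn : g n <= n.
  rewrite leqNgt; apply/negP => L.
  by have := gK n; rewrite ffix // => E; rewrite E ltnn in L.
have [gE|gneq] := eqVneq (g n) n.
  rewrite -addn1; have fix' j : n <= j -> f j = j.
    by rewrite leq_eqVlt => /orP[/eqP <-|/ffix //]; rewrite -{1}gE gK.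
  by apply: realised_widen => //; apply: (IHn _ g).
have gnn : g n < n by rewrite ltn_neqAle gneq.
pose s := swapn (g n) n.
have sK : involutive s by apply: swapnK.
have kapg : kappa (g n) = kappa n by rewrite -{2}[n]gK fkap.
have skap j : kappa (s j) = kappa j.
  have [->|jp] := eqVneq j (g n); first by rewrite /s swapnL.
  have [->|jq] := eqVneq j n; first by rewrite /s swapnR.
  by rewrite /s swapnD.
have rfs : realised r (n + 1) (f \o s).
  have fix' j : n <= j -> (f \o s) j = j.
    rewrite leq_eqVlt => /orP[/eqP <-|nj] /=; first by rewrite /s swapnR gK.
    rewrite /s swapnD ?ffix //; lia.
  apply: realised_widen => //; apply: (IHn _ (s \o g)) => //.
  - by apply: can_comp.
  - by apply: can_comp.
  - by move=> j /=; rewrite fkap skap.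
rewrite -addn1.
have rs : realised r (n + 1) s.
  by apply: realised_swapn; rewrite ?addn1 //; apply: swaps.
apply: (realised_ext (f := (f \o s) \o s)) => [j _ /=|]; first by rewrite sK.
exact: realised_comp.
Qed.

(** A nontrivial relation gives half-commutation, hence the exchange of [p] with
    any position of the same parity.  One of [n] and [n + 1], both fixed by
    [f], is such a position [q]; conjugating by [f] turns the exchange
    of [p] and [q] into that of [f p] and [q], whose parities differ, so the
    block between them has even length and can be removed entirely. *)
Lemma parity_breaking_commutation n f g : cancel f g -> cancel g f ->
  (forall j, n <= j -> f j = j) -> realised r n f ->
  forall p, odd (f p) != odd p -> reversal_of_length r 0.
Proof.
move=> fK gK ffix rf p fp.
have half : reversal_of_length r 1.
  by apply: (nontrivial_half_commutation fK gK ffix rf (j := p)); apply: contraNneq fp => ->.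
have pn : p < n by rewrite ltnNge; apply: contra fp => /ffix ->.
have fpn : f p < n.
  rewrite ltnNge; apply/negP => /ffix /(can_inj fK) E.
  by rewrite E eqxx in fp.
(* the position among n, n + 1 with the parity of p *)
pose q := n + (odd n != odd p).
have qp : odd q = odd p by rewrite /q oddD; case: (odd n) (odd p) => -[].
have nq : n <= q by apply: leq_addr.
have qn : q < n + 2 by rewrite /q; case: (_ != _); lia.
have rf2 : realised r (n + 2) f by apply: realised_widen.
have rs : realised r (n + 2) (swapn p q).
  apply: realised_swapn => //; first exact: leq_trans nq.
  by apply: half_commutation_odd_reversals => //; lia.
have rconj : realised r (n + 2) (swapn (f p) q).
  apply: (realised_ext (f := f \o swapn p q \o g)); last first.
    apply: realised_comp => //; last exact: realised_inv fK rf2.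
    exact: realised_comp.
  move=> j _ /=; have [->|jp] := eqVneq j (f p).
    by rewrite fK !swapnL ffix.
  have [->|jq] := eqVneq j q.
    have gq : g q = q by rewrite -{1}(ffix q nq) fK.
    by rewrite gq !swapnR.
  rewrite !swapnD ?gK //.
    by apply: contraNneq jp => <-; rewrite gK.
  by apply: contraNneq jq => E; rewrite -(ffix q nq) -E gK.
have fq : f p < q by apply: leq_trans nq.
have := shorten_reversals rC (reversal_of_swapn fq qn rconj).
rewrite (_ : odd _ = false) //; lia.
Qed.

End Realised.

(** * Monomial relations in a ring *)

Section Monomials.

Local Open Scope ring_scope.

Variables (A : pzRingType) (N : nat) (x : 'I_N -> A) (I : set A).

Definition word (w : seq 'I_N) : A := \prod_(a <- w) x a.

Definition word_congr (u v : seq 'I_N) : Prop := I (word u - word v).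

Definition two_sided_ideal : Prop :=
  [/\ I 0, forall a b, I a -> I b -> I (a + b),
      forall c a, I a -> I (c * a) & forall c a, I a -> I (a * c)].

Hypotheses (idealI : two_sided_ideal) (sum_sq : \sum_i x i ^+ 2 = 1).

Lemma word_cat u v : word (u ++ v) = word u * word v.
Proof. exact: big_cat. Qed.

(** Inserting [1 = \sum_t x_t ^ 2] writes a monomial as the sum over [t] of the
    monomials with the square [t t] inserted, so a difference of monomials is a
    sum of differences lying in the ideal. *)
Lemma word_congr_capping : capping_congruence word_congr.
Proof.
have [I0 ID IMl IMr] := idealI; rewrite /word_congr; split.
- by move=> u; rewrite subrr.
- by move=> u v /(IMl (-1)); rewrite mulN1r opprB.
- by move=> v u w uv vw; have := ID _ _ uv vw; rewrite addrA subrK.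
- move=> u u' v v' uu' vv'.
  have := ID _ _ (IMr (word v) _ uu') (IMl (word u') _ vv').
  by rewrite !word_cat mulrBl mulrBr addrA subrK.
- move=> u v u' v' H.
  have capE a b : word (a ++ b) = \sum_t word (a ++ [:: t; t] ++ b).
    rewrite word_cat -[word a in LHS]mulr1 -sum_sq mulr_sumr mulr_suml.
    apply: eq_bigr => t _.
    by rewrite !word_cat /word big_cons big_seq1 expr2 !mulrA.
  rewrite !capE -sumrB; elim/big_ind: _ => // t _; exact: H.
Qed.

Definition permutation_relation (k : nat) (s : 'S_k) : Prop :=
  forall i : {ffun 'I_k -> 'I_N},
    I (\prod_(j < k) x (i j) - \prod_(j < k) x (i (s j))).

Definition perm_nat (k : nat) (s : 'S_k) (j : nat) : nat :=
  if insub j is Some o then val (s o : 'I_k) else j.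

Lemma perm_nat_ord k (s : 'S_k) (j : 'I_k) : perm_nat s j = s j.
Proof. by rewrite /perm_nat valK. Qed.

Lemma perm_nat_fixed k (s : 'S_k) j : (k <= j)%N -> perm_nat s j = j.
Proof. by move=> kj; rewrite /perm_nat insubN // -leqNgt. Qed.

Lemma perm_natK k (s : 'S_k) : cancel (perm_nat s) (perm_nat s^-1).
Proof.
move=> j; have [jk|kj] := ltnP j k; last by rewrite !perm_nat_fixed.
by rewrite -[j]/(val (Ordinal jk)) !perm_nat_ord permK.
Qed.

Lemma word_map_iota (i : nat -> 'I_N) (k : nat) :
  word (map i (iota 0 k)) = \prod_(j < k) x (i j).
Proof. by rewrite /word big_map -[k in iota _ k]subn0 big_mkord. Qed.

Lemma permutation_relationP k (s : 'S_k) :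
  permutation_relation s <-> realised word_congr k (perm_nat s).
Proof.
split=> [rs i|rs i].
  have := rs [ffun j => i (val j)]; rewrite /word_congr !word_map_iota.
  congr (I (_ - _)); apply: eq_bigr => j _; first by rewrite ffunE.
  by rewrite ffunE /= perm_nat_ord.
(* the empty word is set apart: there may be no letter to extend i by *)
case: k s rs i => [|k] s rs i.
  by rewrite !big_ord0 subrr; case: idealI.
have := rs (fun j => i (inord j)); rewrite /word_congr !word_map_iota.
congr (I (_ - _)); apply: eq_bigr => j _; first by rewrite inord_val.
by rewrite /= perm_nat_ord inord_val.
Qed.

Let perm_natKV k (s : 'S_k) : cancel (perm_nat s^-1) (perm_nat s).
Proof. by rewrite -{2}[s]invgK; apply: perm_natK. Qed.

Definition even_displacement (k : nat) (s : 'S_k) : Prop :=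
  forall j, odd (s j) = odd j.

Lemma commutation_permutation_relation k (s : 'S_k) :
  reversal_of_length word_congr 0 -> permutation_relation s.
Proof.
move=> comm; apply/permutation_relationP.
apply: (realised_of_transpositions word_congr_capping (kappa := fun=> tt) _
  (perm_natK s) (perm_natKV s) (@perm_nat_fixed _ s)) => // p q _ _.
exact: commutation_reversals word_congr_capping _ comm.
Qed.

Lemma half_commutation_permutation_relation k (s : 'S_k) :
  reversal_of_length word_congr 1 -> even_displacement s ->
  permutation_relation s.
Proof.
move=> half es; apply/permutation_relationP.
apply: (realised_of_transpositions word_congr_capping (kappa := odd) _
  (perm_natK s) (perm_natKV s) (@perm_nat_fixed _ s)) => [p q pq opq|j].
  apply: half_commutation_odd_reversals word_congr_capping _ half _; lia.
have [jk|kj] := ltnP j k; last by rewrite perm_nat_fixed.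
by have := es (Ordinal jk); rewrite -perm_nat_ord.
Qed.

Lemma nontrivial_permutation_relation k (s : 'S_k) :
  permutation_relation s -> s != 1%g -> reversal_of_length word_congr 1.
Proof.
move=> /permutation_relationP rs s1.
have [j sj] : exists j, s j != j.
  apply: contra_neqP s1 => H; apply/permP => j; rewrite perm1.
  by apply/eqP/negPn/negP => sj; apply: H; exists j.
apply: (nontrivial_half_commutation word_congr_capping (perm_natK s)
  (perm_natKV s) (@perm_nat_fixed _ s) rs (j := j)).
by rewrite perm_nat_ord.
Qed.

Lemma odd_displacement_permutation_relation k (s : 'S_k) :
  permutation_relation s -> ~ even_displacement s ->
  reversal_of_length word_congr 0.
Proof.
move=> /permutation_relationP rs /existsNP[j /eqP sj].
apply: (parity_breaking_commutation word_congr_capping (perm_natK s)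
  (perm_natKV s) (@perm_nat_fixed _ s) rs (p := j)).
by rewrite perm_nat_ord.
Qed.

Lemma commutation_relationsP :
  (forall i j, I (x i * x j - x j * x i)) <-> reversal_of_length word_congr 0.
Proof.
have E i j : word [:: i; j] = x i * x j by rewrite /word big_cons big_seq1.
split=> [H a c [|//] _|H i j]; first by rewrite /word_congr !E.
by have := H i j [::] erefl; rewrite /word_congr !E.
Qed.

Lemma half_commutation_relationsP :
  (forall i j k, I (x i * x j * x k - x k * x j * x i)) <->
  reversal_of_length word_congr 1.
Proof.
have E i j k : word [:: i; j; k] = x i * x j * x k.
  by rewrite /word !big_cons big_nil mulr1 mulrA.
split=> [H a c [|b [|//]] // _|H i j k]; first by rewrite /word_congr !E.
by have := H i k [:: j] erefl; rewrite /word_congr !E.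
Qed.

End Monomials.

(** * Spheres as closed ideals *)

Section Spheres.

Local Open Scope classical_set_scope.
Local Open Scope ring_scope.

Variables (R : realType) (A : cstarType R).

Lemma obtained_viaP (rel : set (A * A)) a b :
  rel (a, b) -> nc_kernel (obtained_via rel) (a - b).
Proof. by move=> rab I [_]; apply; exists (a, b). Qed.

Lemma obtained_via_sub (rel : set (A * A)) (Y : nc_subset A) :
  (forall a b, rel (a, b) -> nc_kernel Y (a - b)) ->
  nc_kernel (obtained_via rel) `<=` nc_kernel Y.
Proof.
move=> H; apply: smallest_sub; first exact: nc_kernel_closed_ideal.
by move=> _ [[a b] rab <-]; apply: H.
Qed.

Lemma nc_kernel_ideal (Y : nc_subset A) : two_sided_ideal (nc_kernel Y).
Proof. by case: (nc_kernel_closed_ideal Y). Qed.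

End Spheres.

Section MonomialSpheres.

Local Open Scope classical_set_scope.
Local Open Scope ring_scope.

Variables (R : realType) (N : nat) (A : cstarType R) (x : 'I_N -> A).
Hypothesis sum_sq : \sum_i x i ^+ 2 = 1.

Let via (E : forall k, set 'S_k) := obtained_via (monomial_relations x E).

Lemma monomial_via_sub (E : forall k, set 'S_k) (Y : nc_subset A) :
  (forall k (s : 'S_k), E k s -> permutation_relation x (nc_kernel Y) s) ->
  nc_kernel (via E) `<=` nc_kernel Y.
Proof.
move=> H; apply: obtained_via_sub => a b [k [s [i [Es [-> ->]]]]]; exact: H.
Qed.

Lemma via_relation (E : forall k, set 'S_k) k (s : 'S_k) :
  E k s -> permutation_relation x (nc_kernel (via E)) s.
Proof. by move=> Es i; apply: obtained_viaP; exists k, s, i. Qed.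

Lemma classical_sphere_sub (Y : nc_subset A) :
  reversal_of_length (word_congr x (nc_kernel Y)) 0 ->
  nc_kernel (classical_sphere x) `<=` nc_kernel Y.
Proof.
move=> /(commutation_relationsP x (nc_kernel Y)) H; apply: obtained_via_sub => a b.
by move=> [i [j [-> ->]]]; apply: H.
Qed.

Lemma half_liberated_sphere_sub (Y : nc_subset A) :
  reversal_of_length (word_congr x (nc_kernel Y)) 1 ->
  nc_kernel (half_liberated_sphere x) `<=` nc_kernel Y.
Proof.
move=> /(half_commutation_relationsP x (nc_kernel Y)) H; apply: obtained_via_sub => a b.
by move=> [i [j [k [-> ->]]]]; apply: H.
Qed.

Lemma classical_sphere_commutation :
  reversal_of_length (word_congr x (nc_kernel (classical_sphere x))) 0.
Proof.
by apply/commutation_relationsP => i j; apply: obtained_viaP; exists i, j.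
Qed.

Lemma half_liberated_sphere_half_commutation :
  reversal_of_length (word_congr x (nc_kernel (half_liberated_sphere x))) 1.
Proof.
by apply/half_commutation_relationsP => i j k; apply: obtained_viaP;
  exists i, j, k.
Qed.

(** The three lemmas below cover all families [E]: some member breaks the parity
    of positions, or all preserve it and some is nontrivial, or all are
    trivial. *)
Lemma via_classical (E : forall k, set 'S_k) k (s : 'S_k) :
  E k s -> ~ even_displacement s -> subset_eq (via E) (classical_sphere x).
Proof.
move=> Es os; apply/seteqP; split.
  apply: monomial_via_sub => l t _.
  apply: (commutation_permutation_relation (nc_kernel_ideal _) sum_sq).
  exact: classical_sphere_commutation.
apply: classical_sphere_sub.
exact: (odd_displacement_permutation_relation (nc_kernel_ideal (via E)) sum_sq
  (via_relation Es) os).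
Qed.

Lemma via_half_liberated (E : forall k, set 'S_k) k (s : 'S_k) :
  (forall l (t : 'S_l), E l t -> even_displacement t) ->
  E k s -> s != 1%g -> subset_eq (via E) (half_liberated_sphere x).
Proof.
move=> evenE Es s1; apply/seteqP; split.
  apply: monomial_via_sub => l t /evenE et.
  apply: (half_commutation_permutation_relation (nc_kernel_ideal _) sum_sq) => //.
  exact: half_liberated_sphere_half_commutation.
apply: half_liberated_sphere_sub.
exact: (nontrivial_permutation_relation (nc_kernel_ideal (via E)) sum_sq
  (via_relation Es) s1).
Qed.

Lemma via_free (E : forall k, set 'S_k) :
  (forall k (s : 'S_k), E k s -> s = 1%g) -> subset_eq (via E) (free_sphere A).
Proof.
move=> E1; apply/seteqP; split; last by apply: obtained_via_sub.
apply: monomial_via_sub => k s /E1-> i.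
under [X in _ - X]eq_bigr do rewrite perm1.
by rewrite subrr; case: (nc_kernel_ideal (free_sphere A)).
Qed.

End MonomialSpheres.

Theorem theorem1p4 (R : realType) (N : nat) (A : cstarType R) (x : 'I_N -> A)
    (Ax : is_free_sphere x) :
  (subset_le (classical_sphere x) (half_liberated_sphere x) /\
   subset_le (half_liberated_sphere x) (free_sphere A)) /\
  (monomial_sphere x (classical_sphere x) /\
   monomial_sphere x (half_liberated_sphere x) /\
   monomial_sphere x (free_sphere A)) /\
  (forall S : nc_subset A, monomial_sphere x S ->
     subset_eq S (classical_sphere x) \/
     subset_eq S (half_liberated_sphere x) \/
     subset_eq S (free_sphere A)).
Proof.
have [[_ sum_sq] _] := Ax.
split; [split|split; [split; [|split]|]].
- apply: half_liberated_sphere_sub.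
  apply: (commutation_half_commutation (word_congr_capping (nc_kernel_ideal _) sum_sq)).
  exact: classical_sphere_commutation.
- by apply: obtained_via_sub.
- exists (fun _ _ => True); apply/esym.
  apply: (via_classical sum_sq (k := 2) (s := tperm ord0 ord_max)) => //.
  by move=> /(_ ord0); rewrite tpermL.
- exists even_displacement; apply/esym.
  apply: (via_half_liberated sum_sq (k := 3) (s := tperm ord0 ord_max)) => //.
    by move=> j; case: tpermP => [->|->|].
  by apply/eqP => /permP/(_ ord0); rewrite tpermL perm1.
- by exists (fun _ _ => False); apply/esym/via_free.
move=> S [E SE].
have [[k [s [Es os]]]|evenE] :=
  pselect (exists k (s : 'S_k), E k s /\ ~ even_displacement s).
  by left; rewrite /subset_eq SE; apply: via_classical os.
have {}evenE l (t : 'S_l) : E l t -> even_displacement t.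
  by move=> Et; apply: contrapT => ot; apply: evenE; exists l, t.
have [[k [s [Es s1]]]|trivE] := pselect (exists k (s : 'S_k), E k s /\ s != 1%g).
  by right; left; rewrite /subset_eq SE; apply: via_half_liberated s1.
right; right; rewrite /subset_eq SE; apply: via_free => k s Es.
by apply/eqP/negPn/negP => s1; apply: trivE; exists k, s.
Qed.
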